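(* There exists a simple convex polytope $P$ that is flag, i.e. such that the boundary complex $X$ of the simplicial convex polytope dual to $P$ is a flag simplicial complex, and whose f-polynomial $f_X(t)=\sum_{\sigma\in X}t^{\#\sigma}$ has non-real roots.
   Context: A simplicial complex $X$ is flag if every finite set of pairwise adjacent vertices of $X$ is a simplex of $X$. The sum in $f_X$ runs over all simplices $\sigma$ of $X$, including the empty one, and $\#\sigma$ is the number of vertices of $\sigma$. The f-polynomial of the simple polytope $P$ is taken to be that of the boundary complex $X$ of its dual. *)

(* Defs.v *)
From HB Require Import structures.
From mathcomp Require Import all_boot all_order all_algebra finmap.
From mathcomp Require Import all_classical all_reals.
From mathcomp Require Import complex.

Set Implicit Arguments.
Unset Strict Implicit.
Unset Printing Implicit Defensive.

Import Order.TTheory GRing.Theory Num.Theory.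

Local Open Scope classical_set_scope.
Local Open Scope ring_scope.

Definition dot (R : realFieldType) (n : nat) (x y : 'rV[R]_n) : R :=
  \sum_(i < n) x 0 i * y 0 i.

Definition conv_hull (R : realFieldType) (n k : nat) (v : 'I_k -> 'rV[R]_n) :
    set 'rV[R]_n :=
  [set x | exists a : 'I_k -> R,
     [/\ forall i, 0 <= a i, \sum_i a i = 1 & x = \sum_i a i *: v i]].

Definition affinely_independent (R : realFieldType) (n k : nat)
    (v : 'I_k -> 'rV[R]_n) : Prop :=
  forall a : 'I_k -> R, \sum_i a i = 0 -> \sum_i a i *: v i = 0 ->
  forall i, a i = 0.

(* [has_dim A d]: some d + 1 affinely independent points of A affinely span A.
   No d fits the empty set, whose dimension is -1. *)
Definition has_dim (R : realFieldType) (n : nat) (A : set 'rV[R]_n) (d : nat) :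
    Prop :=
  exists v : 'I_d.+1 -> 'rV[R]_n,
    [/\ affinely_independent v,
        forall i, A (v i)
      & forall x, A x -> exists a : 'I_d.+1 -> R,
          \sum_i a i = 1 /\ x = \sum_i a i *: v i].

Definition is_polytope (R : realFieldType) (n : nat) (P : set 'rV[R]_n) : Prop :=
  exists (k : nat) (v : 'I_k -> 'rV[R]_n), P = conv_hull v.

(* The case k = 0 is the empty simplex. *)
Definition is_simplex (R : realFieldType) (n : nat) (F : set 'rV[R]_n) : Prop :=
  exists (k : nat) (v : 'I_k -> 'rV[R]_n),
    affinely_independent v /\ F = conv_hull v.

(* The case c = 0 is allowed, so that set0 (b = 1) and P (b = 0) are faces. *)
Definition is_face (R : realFieldType) (n : nat) (P F : set 'rV[R]_n) : Prop :=
  exists (c : 'rV[R]_n) (b : R),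
    (forall x, P x -> dot c x <= b) /\ F = P `&` [set x | dot c x = b].

Definition is_proper_face (R : realFieldType) (n : nat) (P F : set 'rV[R]_n) :
    Prop :=
  is_face P F /\ F <> P.

Definition vertices (R : realFieldType) (n : nat) (P : set 'rV[R]_n) :
    set 'rV[R]_n :=
  [set v : 'rV[R]_n | is_face P [set v]].

Definition is_facet (R : realFieldType) (n : nat) (P F : set 'rV[R]_n) : Prop :=
  is_face P F /\ exists d : nat, has_dim P d.+1 /\ has_dim F d.

Definition simple_polytope (R : realFieldType) (n : nat) (P : set 'rV[R]_n) :
    Prop :=
  is_polytope P /\
  exists d : nat, has_dim P d /\
    forall v, vertices P v -> ([set F | is_facet P F /\ F v] #= `I_d)%card.

Definition simplicial_polytope (R : realFieldType) (n : nat)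
    (Q : set 'rV[R]_n) : Prop :=
  is_polytope Q /\ forall F, is_proper_face Q F -> is_simplex F.

(* Duality is combinatorial: the face lattices are anti-isomorphic.  It fixes Q
   up to combinatorial equivalence. *)
Definition dual_polytopes (R : realFieldType) (n m : nat)
    (P : set 'rV[R]_n) (Q : set 'rV[R]_m) : Prop :=
  exists phi : set 'rV[R]_n -> set 'rV[R]_m,
    set_bij [set F | is_face P F] [set G | is_face Q G] phi /\
    forall F G, is_face P F -> is_face P G ->
      (F `<=` G <-> phi G `<=` phi F).

(* As an abstract complex: a proper face is recorded by its set of vertices. *)
Definition boundary_complex (R : realFieldType) (n : nat) (Q : set 'rV[R]_n) :
    set {fset 'rV[R]_n} :=
  [set s : {fset 'rV[R]_n} |
     exists F, is_proper_face Q F /\ [set` s] = vertices Q `&` F].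

(* The empty simplex is included; the vertices of X are the x with
   [fset x] in X. *)
Definition simplicial_complex (K : choiceType) (X : set {fset K}) : Prop :=
  X fset0 /\ forall s t : {fset K}, X s -> (t `<=` s)%fset -> X t.

Definition flag_complex (K : choiceType) (X : set {fset K}) : Prop :=
  simplicial_complex X /\
  forall s : {fset K},
    (forall x, x \in s -> X [fset x]%fset) ->
    (forall x y, x \in s -> y \in s -> x != y -> X [fset x; y]%fset) ->
    X s.

(* The sum is the intended one when X is finite, and 0 by convention otherwise;
   the boundary complex of a polytope is always finite. *)
Definition f_polynomial (K : choiceType) (X : set {fset K}) : {poly int} :=
  \sum_(s \in X) ('X^#|` s| : {poly int}).

Definition has_nonreal_root (R : rcfType) (p : {poly int}) : Prop :=
  exists z : R[i], root (map_poly intr p) z /\ z \isn't Num.real.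

(* Main.v *)
Require Import Defs.
From mathcomp Require Import all_boot all_order all_algebra finmap.
From mathcomp Require Import all_classical all_reals.
From mathcomp Require Import complex.
From mathcomp Require Import zify ring lra.

Set Implicit Arguments.
Unset Strict Implicit.
Unset Printing Implicit Defensive.

Import Order.TTheory GRing.Theory Num.Theory.

Local Open Scope classical_set_scope.
Local Open Scope ring_scope.

(** Truncating a flag simple polytope along a face of codimension two keeps it
    flag and simple; dually, an edge of the complex X is subdivided, and this
    adds t(1 + t) f_L(t) to f_X(t), where L is the link of that edge.  Write
    s = t + t^2.  The 6-cube, whose dual complex is a join of six pairs of
    points, has f-polynomial (1 + 2t)^6 = (1 + 4s)^3.  Three truncations, each
    involving its own pair of coordinates, make it a product of three pentagons,
    with f-polynomial (1 + 5s)^3.  A fourth one cuts off a face where two of the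
    pentagons contribute one edge each; the link there is a join of two pairs
    of points and a pentagon.  A fifth one cuts off the intersection of the new
    facet with a facet of the third pentagon; the link there is a join of four
    pairs of points.  Hence f_X is
      (1 + 5s)^3 + s(1 + 4s)(1 + 5s) + s(1 + 4s)^2 = 1 + 17s + 92s^2 + 161s^3.
    The roots s are the inverses of the roots of y^3 + 17y^2 + 92y + 161, whose
    discriminant is -23, so two of them are not real, and neither is any t with
    t + t^2 equal to such an s.

    The truncated cube is realized as P = {x | dot (a i) x <= 1 for all i} for
    seventeen vectors a i, and its dual as Q, the convex hull of the a i.  The
    combinatorics of both is read off the active sets {i | dot (a i) x = 1} of
    the points x of P.  A nonempty face of P is the set of points whose active
    set contains a given active set s ([face_polarE]); the faces of Q other than
    Q are the hulls of the a i with i in an active set ([face_hullE]); this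
    makes P and Q dual ([polar_dual]).  If each subset of an active set is
    active, then P is simple and Q is simplicial ([polar_simple],
    [hull_simplicial]).  If moreover the active sets are the cliques of a graph,
    then X is the clique complex of that graph, hence flag, and f_X counts
    cliques ([boundary_flag], [f_polynomial_boundary]).

    For the truncated cube, [facets_disjoint] shows that active sets are
    cliques, and an explicit integral point in the relative interior of the face
    of each of the 1691 cliques shows the converse ([cliques_realized]).
    Counting the cliques by size gives f_X. *)

(** * Points, hulls and dimension *)

Section Dot.
Context {R : realFieldType} {n : nat}.
Implicit Types x y z : 'rV[R]_n.

Lemma dotC x y : dot x y = dot y x.
Proof. by apply: eq_bigr => i _; rewrite mulrC. Qed.

Lemma dotDr x y z : dot x (y + z) = dot x y + dot x z.
Proof. by rewrite -big_split; apply: eq_bigr => i _; rewrite mxE mulrDr. Qed.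

Lemma dotZr x c y : dot x (c *: y) = c * dot x y.
Proof. by rewrite mulr_sumr; apply: eq_bigr => i _; rewrite mxE mulrCA. Qed.

Lemma dot0r x : dot x 0 = 0.
Proof. by rewrite -[0]/(0 : 'rV[R]_n) -(scale0r 0) dotZr mul0r. Qed.

Lemma dotNr x y : dot x (- y) = - dot x y.
Proof. by rewrite -scaleN1r dotZr mulN1r. Qed.

Lemma dot_sumr x (I : Type) (r : seq I) (P : pred I) (F : I -> 'rV[R]_n) :
  dot x (\sum_(i <- r | P i) F i) = \sum_(i <- r | P i) dot x (F i).
Proof. by apply: (big_morph (dot x)); [exact: dotDr | exact: dot0r]. Qed.

Lemma dotZl c x y : dot (c *: x) y = c * dot x y.
Proof. by rewrite dotC dotZr dotC. Qed.

Lemma dot_suml x (I : Type) (r : seq I) (P : pred I) (F : I -> 'rV[R]_n) :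
  dot (\sum_(i <- r | P i) F i) x = \sum_(i <- r | P i) dot (F i) x.
Proof. by rewrite dotC dot_sumr; apply: eq_bigr => i _; rewrite dotC. Qed.

Lemma dot_mulmx x y : dot x y = (x *m y^T) 0 0.
Proof. by rewrite mxE; apply: eq_bigr => i _; rewrite mxE. Qed.

End Dot.

Section Convexity.
Context {R : realFieldType} {n : nat}.

Lemma conv_hull_vertex k (v : 'I_k -> 'rV[R]_n) i : conv_hull v (v i).
Proof.
exists (fun j => (j == i)%:R); split=> [j||]; first exact: ler0n.
  by rewrite (bigD1 i) //= eqxx big1 ?addr0 // => j /negPf->.
rewrite (bigD1 i) //= eqxx scale1r big1 ?addr0 // => j /negPf->.
by rewrite scale0r.
Qed.

Lemma conv_hull_convex k (v : 'I_k -> 'rV[R]_n) x y c d :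
  conv_hull v x -> conv_hull v y -> 0 <= c -> 0 <= d -> c + d = 1 ->
  conv_hull v (c *: x + d *: y).
Proof.
move=> [f [f0 f1 ->]] [g [g0 g1 ->]] c0 d0 cd.
exists (fun i => c * f i + d * g i); split=> [i||].
- by rewrite addr_ge0 ?mulr_ge0.
- by rewrite big_split -!mulr_sumr f1 g1 !mulr1.
- rewrite !scaler_sumr -big_split; apply: eq_bigr => i _.
  by rewrite scalerDl !scalerA.
Qed.

(** More affine combinations of [d + 1] points than [d + 1] are dependent,
    because the matrix of their coefficients has a kernel. *)
Lemma affinely_independent_leq (A : set 'rV[R]_n) d e
    (w : 'I_e.+1 -> 'rV[R]_n) :
  has_dim A d -> affinely_independent w -> (forall i, A (w i)) -> (e <= d)%N.
Proof.
move=> [v [_ _ Av]] w_free wA; rewrite leqNgt; apply/negP => lt_de.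
have [c c_aff] := choice (fun i => Av _ (wA i)).
pose C := \matrix_(i < e.+1, j < d.+1) c i j.
have /rowV0Pn[u uK u_neq0] : kermx C != 0.
  by rewrite -mxrank_eq0 mxrank_ker subn_eq0 -ltnNge (leq_ltn_trans (rank_leq_col C)).
move/sub_kermxP: uK => uC.
have uc j : \sum_i u 0 i * c i j = 0.
  have /rowP/(_ j) := uC; rewrite mxE [in RHS]mxE => uCj; rewrite -[RHS]uCj.
  by apply: eq_bigr => i _; rewrite mxE.
suff u0 i : u 0 i = 0 by case/eqP: u_neq0; apply/rowP => i; rewrite u0 mxE.
apply: (w_free (fun i => u 0 i)).
  transitivity (\sum_i \sum_j u 0 i * c i j).
    by apply: eq_bigr => j _; rewrite -mulr_sumr (c_aff j).1 mulr1.
  by rewrite exchange_big big1 // => j _; exact: uc.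
transitivity (\sum_i \sum_j (u 0 i * c i j) *: v j).
  apply: eq_bigr => j _; rewrite {1}(c_aff j).2 scaler_sumr.
  by apply: eq_bigr => l _; rewrite scalerA.
by rewrite exchange_big big1 // => j _; rewrite -scaler_suml uc scale0r.
Qed.

Lemma has_dim_unique (A : set 'rV[R]_n) d e :
  has_dim A d -> has_dim A e -> d = e.
Proof.
move=> Ad Ae; have [v [v_free vA _]] := Ad; have [w [w_free wA _]] := Ae.
apply/eqP; rewrite eqn_leq.
by rewrite (affinely_independent_leq Ae v_free) ?(affinely_independent_leq Ad w_free).
Qed.

Lemma has_dim_point (x : 'rV[R]_n) : has_dim [set x] 0.
Proof.
exists (fun=> x); split=> // [c|y ->].
  by rewrite big_ord1 => c0 _ i; rewrite ord1.
by exists (fun=> 1); rewrite !big_ord1 scale1r.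
Qed.

End Convexity.

(** * Polar duality through active constraints *)

Section Polar.
Context {R : realFieldType} {n k : nat} (a : 'I_k -> 'rV[R]_n).
Implicit Types (x y : 'rV[R]_n) (s : {set 'I_k}).

Definition polar : set 'rV[R]_n := [set x | forall i, dot (a i) x <= 1].

Definition active x : {set 'I_k} := [set i | dot (a i) x == 1]%SET.

Definition polar_face s : set 'rV[R]_n := [set x | polar x /\ s \subset active x].

Definition hull_face s : set 'rV[R]_n :=
  [set y | exists c : 'I_k -> R, [/\ forall i, 0 <= c i, \sum_i c i = 1,
     forall i, i \notin s -> c i = 0 & y = \sum_i c i *: a i]].

(** The recession cone of [polar] is trivial. *)
Definition bounded_polar := forall y, (forall i, dot (a i) y <= 0) -> y = 0.

Lemma activeP x i : reflect (dot (a i) x = 1) (i \in active x).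
Proof. by rewrite inE; exact: eqP. Qed.

Lemma polar0 : polar 0.
Proof. by move=> i; rewrite dot0r ler01. Qed.

Lemma active0 : active 0 = finset.set0.
Proof. by apply/setP => i; rewrite !inE dot0r eq_sym oner_eq0. Qed.

Lemma polar_convex x y c d :
  polar x -> polar y -> 0 <= c -> 0 <= d -> c + d = 1 ->
  polar (c *: x + d *: y).
Proof.
move=> Px Py c0 d0 cd i; rewrite dotDr !dotZr -cd.
by rewrite lerD // ler_piMr.
Qed.

Lemma active_mid x y : polar x -> polar y ->
  active (2^-1 *: x + 2^-1 *: y) = active x :&: active y.
Proof.
move=> Px Py; apply/setP => i; rewrite !inE dotDr !dotZr.
have := Px i; have := Py i => hy hx; apply/eqP/andP => [h|[/eqP-> /eqP->]].
  by split; apply/eqP; lra.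
by lra.
Qed.

(** The inactive constraints are strict at [x], so they survive a short step. *)
Lemma polar_step x y : polar x -> (forall i, i \in active x -> dot (a i) y <= 0) ->
  exists2 e, 0 < e & forall d, 0 <= d <= e -> polar (x + d *: y).
Proof.
move=> Px xy.
pose f i := (1 - dot (a i) x) / (`|dot (a i) y| + 1).
have den_gt0 i : 0 < `|dot (a i) y| + 1 by rewrite ltr_wpDl ?normr_ge0.
exists (\big[Order.min/1]_(i | i \notin active x) f i).
  apply: lt_bigmin => // i; rewrite inE => nix.
  by rewrite divr_gt0 // subr_gt0 lt_neqAle nix Px.
move=> d /andP[d0 de] i; rewrite dotDr dotZr.
have [ix|nix] := boolP (i \in active x).
  by rewrite (activeP _ _ ix) gerDl mulr_ge0_le0 // xy.
have : d <= f i by apply: le_trans de _; exact: bigmin_le_cond.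
rewrite ler_pdivlMr // => le_d.
have : d * dot (a i) y <= d * (`|dot (a i) y| + 1).
  by rewrite ler_wpM2l // (le_trans (ler_norm _)) // lerDl.
lra.
Qed.

(** A point of least active set lies in the relative interior: from it one can
    step slightly backwards from any point of the same [polar_face], which
    forces the supporting functional to be maximal there too. *)
Lemma face_polarE F y : is_face polar F -> F y ->
  exists x, [/\ polar x, F x & F = polar_face (active x)].
Proof.
move=> [c [b [Pb FE]]] Fy.
pose S s := `[< exists x, F x /\ active x = s >].
have Sy : S (active y) by apply/asboolP; exists y.
case: (arg_minnP (fun s : {set 'I_k} => #|s|) Sy) => _ /asboolP[x [Fx <-]] xmin.
have FP z : F z -> polar z /\ dot c z = b by rewrite FE.
have [Px cx] := FP x Fx.
exists x; split=> //; apply/seteqP; split=> z.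
  move=> Fz; have [Pz cz] := FP z Fz; split=> //.
  have half : (0 : R) <= 2^-1 by lra.
  have Fm : F (2^-1 *: x + 2^-1 *: z).
    rewrite FE; split; first by apply: polar_convex => //; lra.
    by rewrite /= dotDr !dotZr cx cz; lra.
  have /xmin : S (active (2^-1 *: x + 2^-1 *: z)) by apply/asboolP; eexists; split; first exact: Fm.
  rewrite active_mid // => le_x.
  have /eqP <- : active x :&: active z == active x.
    by rewrite eqEcard finset.subsetIl.
  exact: finset.subsetIr.
move=> [Pz xz]; rewrite FE; split=> //=.
have [e e0 /(_ e)] : exists2 e, 0 < e &
    forall d, 0 <= d <= e -> polar (x + d *: (x - z)).
  apply: polar_step => // i ix; rewrite dotDr dotNr.
  by rewrite (activeP _ _ ix) (activeP _ _ (fintype.subsetP xz _ ix)) subrr.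
rewrite lexx ltW // => /(_ isT)/Pb; rewrite dotDr dotZr dotDr dotNr cx.
rewrite gerDl pmulr_rle0 // subr_le0 => le_bz.
by apply/eqP; rewrite eq_le le_bz Pb.
Qed.

(** The sum of the constraints in [s] is maximal exactly where all of them are
    tight. *)
Lemma polar_face_face s : is_face polar (polar_face s).
Proof.
exists (\sum_(i in s) a i), (\sum_(i in s) 1); split=> [x Px|].
  by rewrite dot_suml ler_sum.
apply/seteqP; split=> x [Px sx]; split=> //=.
  by rewrite dot_suml; apply: eq_bigr => i /(fintype.subsetP sx)/activeP.
apply/fintype.subsetP => i si; apply/activeP/eqP; rewrite eq_le Px /=.
move: sx => /=; rewrite dot_suml (bigD1 i) //= [RHS](bigD1 i) //= => sx.
rewrite -(lerD2r (\sum_(j in s | j != i) 1)) -sx lerD2l.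
by apply: ler_sum => j _; exact: Px.
Qed.

Lemma polar_faceT : polar_face finset.set0 = polar.
Proof. by apply/seteqP; split=> x; [case | split; rewrite ?finset.sub0set]. Qed.

Lemma hull_faceP s y : hull_face s y -> conv_hull a y.
Proof. by move=> [c [c0 c1 _ ->]]; exists c. Qed.

Lemma hull_face_vertex s i : i \in s -> hull_face s (a i).
Proof.
move=> si; exists (fun j => (j == i)%:R); split=> [j||j js|]; first exact: ler0n.
- by rewrite (bigD1 i) //= eqxx big1 ?addr0 // => j /negPf->.
- by case: eqP => // ji; rewrite ji si in js.
rewrite (bigD1 i) //= eqxx scale1r big1 ?addr0 // => j /negPf->.
by rewrite scale0r.
Qed.

Lemma dot_hull_face s x y : hull_face s y -> s \subset active x -> dot x y = 1.
Proof.
move=> [c [c0 c1 cs ->]] sx; rewrite dot_sumr -c1; apply: eq_bigr => i _.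
rewrite dotZr dotC; have [/(fintype.subsetP sx)/activeP->|/cs->] := boolP (i \in s).
  by rewrite mulr1.
by rewrite mul0r.
Qed.

(** Where a convex combination of values at most 1 equals 1, all its terms of
    positive weight equal 1.  So every supporting hyperplane of the hull of the
    form [dot x y = 1] cuts out the hull of the vectors active at [x]. *)
Lemma hull_faceE x : polar x ->
  conv_hull a `&` [set y | dot x y = 1] = hull_face (active x).
Proof.
move=> Px; apply/seteqP; split=> y; last first.
  by move=> sy; split; [exact: hull_faceP sy | exact: dot_hull_face sy _].
move=> [[c [c0 c1 ->]]] /= cx; exists c; split=> // i nix.
have pos j : 0 <= c j * (1 - dot (a j) x) by rewrite mulr_ge0 ?subr_ge0 ?Px.
have sum0 : \sum_j c j * (1 - dot (a j) x) = 0.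
  under eq_bigr do rewrite mulrBr mulr1.
  rewrite sumrB c1 -[X in X - _]cx dot_sumr -sumrB big1 // => j _.
  by rewrite dotZr dotC subrr.
have /eqP : c i * (1 - dot (a i) x) = 0.
  by apply: (psumr_eq0P _ sum0) => // j _; exact: pos.
rewrite mulf_eq0 subr_eq0 [1 == _]eq_sym => /orP[/eqP//|].
by move: nix; rewrite inE => /negPf->.
Qed.


Section Bounded.
Hypothesis bounded : bounded_polar.

(** Follow the ray until the first constraint becomes tight; boundedness provides
    one that does. *)
Lemma polar_ray x y : polar x -> y != 0 ->
  (forall i, i \in active x -> dot (a i) y = 0) ->
  exists t, [/\ 0 < t, polar (x + t *: y) & active x \proper active (x + t *: y)].
Proof.
move=> Px y0 xy.
have /existsP[i0 i0y] : [exists i, 0 < dot (a i) y].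
  apply: contraNT y0; rewrite negb_exists => /forallP yle.
  by apply/eqP/bounded => i; rewrite leNgt.
pose f i := (1 - dot (a i) x) / dot (a i) y.
case: (Order.TotalTheory.arg_minP (P := fun i => 0 < dot (a i) y) f i0y) => i iy imin.
have nix : i \notin active x by apply/negP => /xy iy0; rewrite iy0 ltxx in iy.
have fi : f i * dot (a i) y = 1 - dot (a i) x by rewrite divfK // gt_eqF.
exists (f i); split.
- rewrite divr_gt0 // subr_gt0 lt_neqAle Px andbT.
  by move: nix; rewrite inE.
- move=> j; rewrite dotDr dotZr.
  have [jy|jy] := ltP 0 (dot (a j) y).
    have : f i * dot (a j) y <= f j * dot (a j) y by rewrite ler_pM2r ?imin.
    by rewrite /f divfK ?gt_eqF // -/(f i); lra.
  have f_ge0 : 0 <= f i by rewrite mulr_ge0 ?subr_ge0 ?Px // invr_ge0 ltW.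
  by apply: le_trans (Px j); rewrite gerDl mulr_ge0_le0.
apply/properP; split; last first.
  by exists i => //; apply/activeP; rewrite dotDr dotZr fi addrC subrK.
apply/fintype.subsetP => j jx; apply/activeP.
by rewrite dotDr dotZr xy // mulr0 addr0; apply/activeP.
Qed.

Definition rigid s := forall y, (forall i, i \in s -> dot (a i) y = 0) -> y = 0.

(** A point that is not determined by its active constraints lies on a segment
    whose two ends have larger active sets, so by induction every point is in the
    hull of those that are.  There is at most one of these for each set of
    constraints. *)
Lemma polar_polytope : is_polytope polar.
Proof.
pose V s := [set x | [/\ polar x, active x = s & rigid s]].
pose v (j : 'I_#|{set 'I_k}|) := xget 0 (V (enum_val j)).
exists #|{set 'I_k}|, v; apply/seteqP; split=> x; last first.
  move=> [c [c0 c1 ->]] i; rewrite dot_sumr -c1; apply: ler_sum => j _.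
  rewrite dotZr ler_piMr // /v.
  by case: xgetP => [z _ [Pz _ _]|_]; [exact: Pz | rewrite dot0r ler01].
have [m] := ubnP (k - #|active x|); elim: m x => // m IHm x; rewrite ltnS => le_m Px.
have [xR|] := pselect (rigid (active x)).
  suff -> : x = v (enum_rank (active x)) by exact: conv_hull_vertex.
  rewrite /v enum_rankK; apply/esym/xget_unique => // z [Pz zx _].
  apply/subr0_eq/xR => i ix; have iz : i \in active z by rewrite zx.
  by rewrite dotDr dotNr (activeP _ _ ix) (activeP _ _ iz) subrr.
move=> /existsNP[y /not_implyP[xy /eqP y0]].
have step z : z != 0 -> (forall i, i \in active x -> dot (a i) z = 0) ->
    exists2 t, 0 < t & conv_hull v (x + t *: z).
  move=> z0 xz; have [t [t0 Pt /proper_card lt_t]] := polar_ray Px z0 xz.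
  exists t => //; apply: IHm => //; apply: leq_trans le_m.
  have := max_card (mem (active (x + t *: z))); rewrite card_ord => le_k.
  by rewrite ltn_sub2l // (leq_trans lt_t).
have [t t0 xt] := step y y0 xy.
have [|i ix|u u0 xu] := step (- y); rewrite ?oppr_eq0 //.
  by rewrite dotNr xy ?oppr0.
have tu : 0 < t + u by rewrite addr_gt0.
have -> : x = (u / (t + u)) *: (x + t *: y) + (t / (t + u)) *: (x + u *: - y).
  apply/rowP => i; rewrite !mxE.
  by field; rewrite gt_eqF.
apply: conv_hull_convex => //; rewrite ?mulr_ge0 ?invr_ge0 ?ltW //.
by rewrite -mulrDl [u + t]addrC divff // gt_eqF.
Qed.

Hypothesis hull0 : conv_hull a 0.

Lemma polar_hull x y : polar x -> conv_hull a y -> dot x y <= 1.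
Proof.
move=> Px [c [c0 c1 ->]]; rewrite dot_sumr -c1; apply: ler_sum => i _.
by rewrite dotZr dotC ler_piMr.
Qed.

Lemma hull_face_face x : polar x -> is_face (conv_hull a) (hull_face (active x)).
Proof.
by move=> Px; exists x, 1; split; [move=> y; exact: polar_hull | rewrite hull_faceE].
Qed.

Lemma hull_face_proper x : polar x -> hull_face (active x) <> conv_hull a.
Proof.
move=> Px hE; have : hull_face (active x) 0 by rewrite hE.
by move=> /dot_hull_face/(_ (fintype.subxx _))/eqP; rewrite dot0r eq_sym oner_eq0.
Qed.

(** A supporting inequality [dot c y <= b] has [0 <= b], because 0 is in the
    hull; [b = 0] forces [c = 0], and otherwise [b^-1 *: c] is in [polar]. *)
Lemma face_hullE G : is_face (conv_hull a) G ->
  G = conv_hull a \/ exists2 x, polar x & G = hull_face (active x).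
Proof.
move=> [c [b [cb ->]]].
have ab i : dot (a i) c <= b by rewrite dotC cb //; exact: conv_hull_vertex.
have : 0 <= b by rewrite -(dot0r c) cb.
rewrite le_eqVlt => /orP[/eqP b0|b0].
  left; have -> : c = 0 by apply: bounded => i; rewrite b0.
  by apply/seteqP; split=> x; [case | move=> Qx; split=> //=; rewrite dotC dot0r].
have Pc : polar (b^-1 *: c) by move=> i; rewrite dotZr mulrC ler_pdivrMr ?mul1r.
right; exists (b^-1 *: c) => //; rewrite -hull_faceE //.
apply/seteqP; split=> x [Qx] /= cx; split=> //=.
  by rewrite dotZl cx mulVf ?gt_eqF.
apply: (mulfI (x := b^-1)); first by rewrite invr_eq0 gt_eqF.
by rewrite -dotZl cx mulVf ?gt_eqF.
Qed.

Definition dual_face (F : set 'rV[R]_n) : set 'rV[R]_n :=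
  [set y | conv_hull a y /\ forall x, F x -> dot x y = 1].

Lemma dual_face0 : dual_face set0 = conv_hull a.
Proof. by apply/seteqP; split=> y; [case|]. Qed.

Lemma dual_polar_face x : polar x ->
  dual_face (polar_face (active x)) = hull_face (active x).
Proof.
move=> Px; apply/seteqP; split=> y.
  by move=> [Qy Fy]; rewrite -hull_faceE //; split=> //; apply: Fy; split.
move=> xy; split=> [|z [Pz xz]]; first exact: hull_faceP xy.
exact: dot_hull_face xy xz.
Qed.

Lemma face_polar_cases F : is_face polar F ->
  F = set0 \/ exists2 x, polar x & F = polar_face (active x).
Proof.
move=> fF; have [->|/set0P[y Fy]] := eqVneq F set0; first by left.
by right; have [x [Px _ FE]] := face_polarE fF Fy; exists x.
Qed.

(** If [dual_face G] is contained in [dual_face F], the vectors active on [G] lie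
    in [dual_face F], so they are active on [F]. *)
Lemma dual_face_anti F G : is_face polar F -> is_face polar G ->
  (F `<=` G <-> dual_face G `<=` dual_face F).
Proof.
move=> fF fG; split=> [FG y [Qy Gy]|].
  by split=> // x /FG; exact: Gy.
case: (face_polar_cases fF) => [-> _|[x Px ->]]; first exact: sub0set.
case: (face_polar_cases fG) => [->|[z Pz ->]].
  rewrite dual_face0 => /(_ 0 hull0)[_ /(_ x)].
  rewrite dot0r => /(_ (conj Px (fintype.subxx _)))/eqP.
  by rewrite eq_sym oner_eq0.
move=> sub y [Py xy]; split=> //; apply/fintype.subsetP => i iz; apply/activeP.
have /sub[_ /(_ y)] : dual_face (polar_face (active z)) (a i).
  by rewrite dual_polar_face //; exact: hull_face_vertex.
by rewrite dotC; apply.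
Qed.

Lemma polar_dual : dual_polytopes polar (conv_hull a).
Proof.
exists dual_face; split; last exact: dual_face_anti.
have dualE x : polar x -> is_face (conv_hull a) (dual_face (polar_face (active x))).
  by move=> Px; rewrite dual_polar_face //; exact: hull_face_face.
have hullT : is_face (conv_hull a) (conv_hull a).
  exists 0, 0; split=> [x _|]; first by rewrite dotC dot0r.
  by apply/seteqP; split=> x; [move=> Qx; split=> //=; rewrite dotC dot0r | case].
split.
- move=> F /face_polar_cases[->|[x Px ->]] /=; last exact: dualE.
  by rewrite dual_face0.
- move=> F G; rewrite !inE /= => fF fG FG.
  by apply/seteqP; split; apply/dual_face_anti => //; rewrite FG.
- move=> G /face_hullE[->|[x Px ->]].
    exists set0; last exact: dual_face0.
    exists 0, 1; split=> [x _|]; first by rewrite dotC dot0r ler01.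
    apply/seteqP; split=> x // [_ /=]; rewrite dotC dot0r => /eqP.
    by rewrite eq_sym oner_eq0.
  exists (polar_face (active x)); first exact: polar_face_face.
  exact: dual_polar_face.
Qed.

End Bounded.

(** * Simple polars and simplicial hulls *)

(** Active sets form an abstract simplicial complex; this is the combinatorial
    form of the simplicity of [polar]. *)
Definition facial := forall x s, polar x -> s \subset active x ->
  exists2 y, polar y & active y = s.

Section Facial.
Hypotheses (bounded : bounded_polar) (hull0 : conv_hull a 0) (face_sub : facial).

Definition rows s : 'M[R]_(#|s|, n) := \matrix_j a (enum_val j).

Lemma mulmx_rows s (u : 'rV_#|s|) :
  u *m rows s = \sum_j u 0 j *: a (enum_val j).
Proof. by rewrite mulmx_sum_row; apply: eq_bigr => j _; rewrite rowK. Qed.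

(** Pair a linear relation with a point whose active set is [active x], then
    with one whose active set misses a single index [j]: the coefficient of [j]
    vanishes. *)
Lemma row_free_active x : polar x -> row_free (rows (active x)).
Proof.
move=> Px; apply: inj_row_free => u; rewrite mulmx_rows => u0.
have pair y : \sum_j u 0 j * dot (a (enum_val j)) y = 0.
  rewrite -[RHS](dot0r y) -u0 dot_sumr.
  by apply: eq_bigr => j _; rewrite dotZr dotC.
have sum_u : \sum_j u 0 j = 0.
  rewrite -[RHS](pair x); apply: eq_bigr => j _.
  by rewrite (activeP _ _ (enum_valP j)) mulr1.
apply/rowP => j; rewrite mxE.
(* This point [y] is tight on the active set except at the index of [j]. *)
have [|y Py yE] := face_sub (s := active x :\ enum_val j) Px.
  by rewrite subD1set.
have rest : \sum_(i | i != j) u 0 i * dot (a (enum_val i)) y =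
    \sum_(i | i != j) u 0 i.
  apply: eq_bigr => i ij; rewrite (_ : dot _ y = 1) ?mulr1 //.
  apply/activeP; rewrite yE in_setD1 enum_valP andbT.
  by apply: contra ij => /eqP/enum_val_inj->.
have : u 0 j * (dot (a (enum_val j)) y - 1) = 0.
  have := pair y; have := sum_u; rewrite (bigD1 j) //= => sum_j.
  rewrite (bigD1 j) //= rest => pair_j; lra.
move/eqP; rewrite mulf_eq0 => /orP[/eqP//|]; rewrite subr_eq0 => /eqP/activeP.
by rewrite yE !inE eqxx.
Qed.

Lemma rows_affinely_independent s : row_free (rows s) ->
  affinely_independent (fun j : 'I_#|s| => a (enum_val j)).
Proof.
move=> s_free c _ c0 i.
have /(row_free_inj s_free)/rowP/(_ i) : (\row_j c j) *m rows s = 0 *m rows s.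
  by rewrite mulmx_rows mul0mx -[RHS]c0; apply: eq_bigr => j _; rewrite mxE.
by rewrite !mxE.
Qed.

Lemma sum_enum_val (V : nmodType) s (F : 'I_k -> V) :
  (forall i, i \notin s -> F i = 0) ->
  \sum_i F i = \sum_(j < #|s|) F (enum_val j).
Proof.
move=> F0; rewrite -(big_enum_val (A := mem s)) [LHS](bigID (mem s)) /=.
by rewrite [X in _ + X]big1 ?addr0.
Qed.

Lemma hull_face_conv_hull s :
  hull_face s = conv_hull (fun j : 'I_#|s| => a (enum_val j)).
Proof.
apply/seteqP; split=> y [c].
  move=> [c0 c1 cs ->]; exists (fun j => c (enum_val j)); split=> //.
    by rewrite -c1 (sum_enum_val cs).
  by apply: (sum_enum_val (F := fun i => c i *: a i)) => i /cs->; rewrite scale0r.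
move=> [c0 c1 ->].
pose c' i := \sum_(j | enum_val j == i) c j.
have c'E j : c' (enum_val j) = c j.
  by rewrite /c' (big_pred1 j) // => i; rewrite /= (inj_eq enum_val_inj).
have c's i : i \notin s -> c' i = 0.
  by move=> si; rewrite /c' big1 // => j /eqP ji; rewrite -ji enum_valP in si.
exists c'; split=> //.
- by move=> i; apply: sumr_ge0.
- by rewrite (sum_enum_val c's) -c1; apply: eq_bigr.
- rewrite (@sum_enum_val _ s (fun i => c' i *: a i)).
    by apply: eq_bigr => j _; rewrite c'E.
  by move=> i /c's->; rewrite scale0r.
Qed.

Lemma hull_simplicial : simplicial_polytope (conv_hull a).
Proof.
split=> [|G [fG GQ]]; first by exists k, a.
have [//|[x Px ->]] := face_hullE bounded hull0 fG.
exists #|active x|, (fun j => a (enum_val j)); split.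
  exact/rows_affinely_independent/row_free_active.
exact: hull_face_conv_hull.
Qed.

(** Around [x] the face is an open piece of the affine space through [x] whose
    direction is the kernel of [rows (active x)]. *)
Lemma polar_face_dim x : polar x ->
  has_dim (polar_face (active x)) (n - #|active x|).
Proof.
move=> Px; set s := active x; set M := rows s.
have rkK : \rank (kermx M^T) = (n - #|s|)%N.
  by rewrite mxrank_ker mxrank_tr (eqP (row_free_active Px)).
rewrite -rkK; set B := row_base (kermx M^T); set d := \rank _ in B *.
have rowB (j : 'I_d) i : i \in s -> dot (a i) (row j B) = 0.
  move=> si; have : row j B *m M^T = 0.
    apply/sub_kermxP; apply: submx_trans (row_sub _ _) _.
    by rewrite eq_row_base.
  move=> /rowP/(_ (enum_rank_in si i)); rewrite [RHS]mxE => BM.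
  rewrite -BM mxE; apply: eq_bigr => l _; rewrite !mxE enum_rankK_in //.
  by rewrite mulrC.
have /choice[e e_step] (j : 'I_d) : exists e, 0 < e /\ polar (x + e *: row j B).
  have [i si|e e0 Pe] := polar_step (y := row j B) Px; first by rewrite rowB.
  by exists e; split=> //; apply: Pe; rewrite ltW /=.
have e_neq0 j : e j != 0 by rewrite gt_eqF // (e_step j).1.
pose v (i : 'I_d.+1) := if unlift ord0 i is Some j then x + e j *: row j B else x.
have v0 : v ord0 = x by rewrite /v unlift_none.
have vS j : v (lift ord0 j) = x + e j *: row j B by rewrite /v liftK.
have sum_v c : \sum_i c i *: v i =
    (\sum_i c i) *: x + (\row_j (c (lift ord0 j) * e j)) *m B.
  rewrite !big_ord_recl v0 scalerDl -addrA; congr (_ + _).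
  rewrite mulmx_sum_row scaler_suml -big_split; apply: eq_bigr => j _.
  by rewrite vS mxE scalerDr scalerA.
have B_free : row_free B by exact: row_base_free.
exists v; split=> [c c1|i|z [Pz xz]].
- rewrite sum_v c1 scale0r add0r -[RHS](mul0mx _ B) => /(row_free_inj B_free)/rowP c0.
  have cS j : c (lift ord0 j) = 0.
    by have /eqP := c0 j; rewrite !mxE mulf_eq0 (negPf (e_neq0 j)) orbF => /eqP.
  move=> i; case: (unliftP ord0 i) => [j|] -> //.
  by move: c1; rewrite big_ord_recl big1 ?addr0.
- case: (unliftP ord0 i) => [j|] ->; last by rewrite v0; split.
  rewrite vS; split; first exact: (e_step j).2.
  apply/fintype.subsetP => l ls; apply/activeP.
  by rewrite dotDr dotZr rowB // mulr0 addr0; apply/activeP.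
have /submxP[D zE] : (z - x <= B)%MS.
  rewrite eq_row_base; apply/sub_kermxP/rowP => j; rewrite mxE [RHS]mxE.
  transitivity (dot (a (enum_val j)) (z - x)).
    by apply: eq_bigr => l _; rewrite !mxE mulrC.
  rewrite dotDr dotNr (activeP _ _ (enum_valP j)).
  by rewrite (activeP _ _ (fintype.subsetP xz _ (enum_valP j))) subrr.
pose c i := if unlift ord0 i is Some j then D 0 j / e j
            else 1 - \sum_j D 0 j / e j.
have c1 : \sum_i c i = 1.
  rewrite big_ord_recl /c unlift_none -[RHS](subrK (\sum_j D 0 j / e j)).
  by congr (_ + _); apply: eq_bigr => j _; rewrite liftK.
exists c; split=> //; rewrite sum_v c1 scale1r.
suff -> : \row_j (c (lift ord0 j) * e j) = D by rewrite -zE addrC subrK.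
by apply/rowP => j; rewrite mxE /c liftK divfK.
Qed.

Lemma polar_dim : has_dim polar n.
Proof. by have := polar_face_dim polar0; rewrite active0 polar_faceT cards0 subn0. Qed.

Lemma active_leq x : polar x -> (#|active x| <= n)%N.
Proof. by move=> /row_free_active/eqP <-; exact: rank_leq_col. Qed.

(** At a vertex the dimension formula makes the active set have [n] elements, and
    a facet through it is the face of a singleton contained in that set. *)
Lemma polar_simple : simple_polytope polar.
Proof.
split; first exact: polar_polytope.
exists n; split=> [|v vv]; first exact: polar_dim.
have [x [Px <- vE]] := face_polarE vv (erefl v).
have nE : #|active x| = n.
  apply/eqP; rewrite eqn_leq active_leq //= -subn_eq0; apply/eqP.
  have xdim := polar_face_dim Px; rewrite -vE in xdim.
  exact: has_dim_unique xdim (has_dim_point x).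
pose f (j : 'I_#|active x|) := polar_face [set enum_val j]%SET.
have sub1 i : i \in active x -> exists2 y, polar y & active y = [set i]%SET.
  by move=> ix; apply: (face_sub Px); rewrite finset.sub1set.
have -> : [set F | is_facet polar F /\ F x] = f @` setT.
  apply/seteqP; split=> F.
    move=> [[fF [d [Pd Fd]]] Fx].
    have [y [Py _ FE]] := face_polarE fF Fx; move: Fx Fd; rewrite FE => -[_ yx] Fd.
    have dn := has_dim_unique Pd polar_dim.
    have := has_dim_unique Fd (polar_face_dim Py).
    have := active_leq Py => le_yn dE.
    have /eqP/cards1P[i yi] : #|active y| = 1%N by lia.
    have ix : i \in active x by rewrite -finset.sub1set -yi.
    by exists (enum_rank_in ix i) => //; rewrite /f enum_rankK_in // yi.
  move=> [j _ <-]; have jx := enum_valP j; split; last by split; rewrite ?finset.sub1set.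
  split; first exact: polar_face_face.
  have [y Py yE] := sub1 _ jx; exists n.-1.
  have n0 : (0 < n)%N by rewrite -nE (leq_ltn_trans _ (ltn_ord j)).
  rewrite prednK //; split; first exact: polar_dim.
  by have := polar_face_dim Py; rewrite yE cards1 subn1.
apply: card_eq_trans (inj_card_eq _) _.
  move=> i j _ _ fij; apply/esym/enum_val_inj/set1P.
  have [y Py yE] := sub1 _ (enum_valP i).
  have : f i y by split=> //; rewrite yE.
  by rewrite fij => -[_]; rewrite yE finset.sub1set.
have /card_eq_II : #|active x| = n by [].
by apply: card_eq_trans; rewrite card_eq_sym; exact: card_II.
Qed.

End Facial.

(** * Active sets that are the cliques of a graph *)

Section CliqueComplex.
Variable e : rel 'I_k.

Definition clique s := [forall i in s, forall j in s, (i != j) ==> e i j].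

Lemma cliqueP s :
  reflect {in s &, forall i j, i != j -> e i j} (clique s).
Proof.
apply: (iffP forall_inP) => [es i j si sj ij|es i si].
  by have /forall_inP/(_ j sj)/implyP := es i si; apply.
by apply/forall_inP => j sj; apply/implyP; exact: es.
Qed.

Lemma cliqueS s (t : {set 'I_k}) : s \subset t -> clique t -> clique s.
Proof.
move=> /fintype.subsetP st /cliqueP et; apply/cliqueP => i j si sj.
by apply: et; exact: st.
Qed.

Hypothesis bounded : bounded_polar.
Hypothesis hull0 : conv_hull a 0.
Hypothesis active_clique : forall x, polar x -> clique (active x).
Hypothesis clique_active : forall s, clique s -> exists2 x, polar x & active x = s.

Lemma clique_facial : facial.
Proof.
by move=> x s Px sx; apply: clique_active; apply: cliqueS sx (active_clique Px).
Qed.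

Lemma point_active i : exists2 x, polar x & active x = [set i]%SET.
Proof.
apply: clique_active; apply/cliqueP => u v /set1P -> /set1P ->.
by rewrite eqxx.
Qed.

Lemma vertex_inj : injective a.
Proof.
move=> i j aij; have [y _ yi] := point_active i; apply/esym/set1P.
by rewrite -yi; apply/activeP; rewrite -aij; apply/activeP; rewrite yi inE.
Qed.

Lemma hull_face_mem x i : polar x -> hull_face (active x) (a i) <-> i \in active x.
Proof.
move=> Px; split=> [xi|]; last exact: hull_face_vertex.
by apply/activeP; rewrite dotC; apply: (dot_hull_face xi).
Qed.

Lemma vertices_hull : vertices (conv_hull a) = range a.
Proof.
apply/seteqP; split=> v.
  move=> /(face_hullE bounded hull0)[vQ|[x Px vE]].
    have [c [_ c1 _]] := hull0.
    have [i _] : exists i : 'I_k, True.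
      apply: contrapT => noI; have /eqP := c1.
      by rewrite big1 ?(eq_sym 0) ?oner_eq0 // => i _; case: noI; exists i.
    by exists i => //; have := conv_hull_vertex a i; rewrite -vQ.
  have [i ix] : exists i, i \in active x.
    have : hull_face (active x) v by rewrite -vE.
    move=> [c [_ c1 c0 _]]; apply: contrapT => /forallNP no_i.
    by have /eqP := c1; rewrite big1 ?(eq_sym 0) ?oner_eq0 // => i _; apply/c0/negP.
  by exists i => //; have := hull_face_vertex ix; rewrite -vE.
move=> [i _ <-]; have [x Px xi] := point_active i.
rewrite /vertices /=; suff -> : [set a i] = hull_face (active x).
  exact: hull_face_face.
rewrite xi; apply/seteqP; split=> y.
  by move=> ->; apply: hull_face_vertex; rewrite inE.
move=> [c [_ c1 c0 ->]].
have cj j : j != i -> c j = 0 by move=> ji; apply: c0; rewrite inE.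
rewrite (bigD1 i) //= [X in _ + X]big1 => [|j ji]; last by rewrite cj ?scale0r.
by move: c1; rewrite (bigD1 i) //= big1 // !addr0 => ->; rewrite scale1r.
Qed.

Definition vertex_set s : {fset 'rV[R]_n} := [fset a i | i in s]%fset.

Lemma mem_vertex_set s i : (a i \in vertex_set s) = (i \in s).
Proof. by rewrite mem_imfset //; exact: vertex_inj. Qed.

Lemma vertex_set_inj : injective vertex_set.
Proof. by move=> s t st; apply/setP => i; rewrite -!mem_vertex_set st. Qed.

Lemma boundary_complexE :
  boundary_complex (conv_hull a) = vertex_set @` [set` clique].
Proof.
have trace x : polar x ->
    vertices (conv_hull a) `&` hull_face (active x) = [set` vertex_set (active x)].
  move=> Px; rewrite vertices_hull; apply/seteqP; split=> y /=.
    by move=> [[i _ <-]]; rewrite hull_face_mem // mem_vertex_set.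
  by move=> /imfsetP[i /= ix ->]; split; [exists i | rewrite hull_face_mem].
apply/seteqP; split=> t.
  move=> [F [[fF FQ] tF]].
  have [//|[x Px FE]] := face_hullE bounded hull0 fF.
  exists (active x); first exact: active_clique.
  apply/fsetP => y; have := congr1 (fun A : set _ => A y) tF.
  by rewrite FE trace //= => yE; apply/idP/idP; rewrite yE.
move=> [s /= es <-]; have [x Px xs] := clique_active es; rewrite -xs.
exists (hull_face (active x)); rewrite trace //; split=> //.
by split; [exact: hull_face_face | exact: hull_face_proper].
Qed.

Lemma boundary_flag : flag_complex (boundary_complex (conv_hull a)).
Proof.
pose pre (t : {fset 'rV[R]_n}) := [set i | a i \in t]%SET.
have XP t : boundary_complex (conv_hull a) t <->
    (forall y, y \in t -> range a y) /\ clique (pre t).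
  rewrite boundary_complexE; split=> [[s /= es <-]|[ta et]].
    split=> [y /imfsetP[i _ ->]|]; first by exists i.
    by rewrite (_ : pre _ = s) //; apply/setP => i; rewrite inE mem_vertex_set.
  exists (pre t) => //; apply/fsetP => y; apply/imfsetP/idP => /=.
    by move=> [i it ->]; rewrite inE in it.
  by move=> yt; have [i _ iy] := ta y yt; exists i; rewrite // inE iy.
split; first split.
- apply/XP; split=> [y|]; first by rewrite inE.
  by apply/cliqueP => i j; rewrite !inE.
- move=> s t /XP[sa es] /fsubsetP ts; apply/XP; split=> [y /ts/sa//|].
  by apply: cliqueS es; apply/fintype.subsetP => i; rewrite !inE => /ts.
- move=> s s1 s2; apply/XP; split=> [y /s1/XP[+ _]|].
    by apply; rewrite inE.
  apply/cliqueP => i j; rewrite !inE => si sj ij.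
  have aij : a i != a j by rewrite (inj_eq vertex_inj).
  have /XP[_ /cliqueP] := s2 _ _ si sj aij.
  by apply=> //; rewrite !inE eqxx ?orbT.
Qed.

Lemma f_polynomial_boundary :
  f_polynomial (boundary_complex (conv_hull a)) =
  \sum_(s : {set 'I_k} | clique s) 'X^#|s|.
Proof.
have bij : set_bij [set` clique] (vertex_set @` [set` clique]) vertex_set.
  split=> [s es|s t _ _|_ [s es <-]]; [by exists s|exact: vertex_set_inj|by exists s].
rewrite /f_polynomial boundary_complexE (@reindex_fsbig _ _ _ _ _ vertex_set _ _ _ bij).
rewrite -(@bigfs _ _ _ _ (index_enum _)) ?index_enum_uniq //; last first.
  by move=> s _; rewrite mem_index_enum.
apply: eq_bigr => s _; congr ('X^_); rewrite card_imfset; last exact: vertex_inj.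
rewrite cardE; apply/perm_size/uniq_perm; rewrite ?enum_finmem_uniq ?enum_uniq //.
Qed.

End CliqueComplex.

End Polar.

(** * Enumerating cliques *)

Section CliqueEnumeration.

(** A clique contains the first vertex or not.  Sharing the recursive call keeps
    the evaluation proportional to the number of cliques. *)
Fixpoint cliques (e : rel nat) (l : seq nat) : seq (seq nat) :=
  if l is v :: l' then
    let cl := cliques e l' in cl ++ [seq v :: c | c <- cl & all (e v) c]
  else [:: [::]].

Variable e : rel nat.

Lemma mem_cliques l c : (c \in cliques e l) = subseq c l && pairwise e c.
Proof.
elim: l c => [|v l IHl] c /=; first by rewrite inE; case: c.
rewrite mem_cat IHl; case: c => [|x c] /=; first by rewrite sub0seq.
have -> : (x :: c \in [seq v :: c' | c' <- cliques e l & all (e v) c']) =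
    [&& x == v, all (e x) c, subseq c l & pairwise e c].
  apply/mapP/and4P => [[c' + [-> ->]]|[/eqP-> ev cl ec]].
    by rewrite mem_filter IHl => /and3P[].
  by exists c => //; rewrite mem_filter IHl ev cl.
case: eqP => [->|_] /=; last by rewrite orbF.
case: (boolP (subseq c l)) => [cl|ncl] /=.
  by case: (all _ _); case: (pairwise _ _); rewrite ?andbF ?orbT.
have /negPf-> : ~~ subseq (v :: c) l.
  by apply: contra ncl; apply: subseq_trans; exact: subseq_cons.
by rewrite !andbF.
Qed.

Lemma cliques_uniq l : uniq l -> uniq (cliques e l).
Proof.
elim: l => //= v l IHl /andP[vl /IHl ul].
rewrite cat_uniq ul map_inj_uniq ?filter_uniq //= ?andbT; last by move=> c d [].
apply/hasPn => _ /mapP[c _ ->]; rewrite /= mem_cliques; apply/negP => /andP[+ _].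
by move=> /mem_subseq/(_ v); rewrite mem_head (negPf vl) => /(_ isT).
Qed.

Hypothesis e_sym : symmetric e.

Lemma pairwise_distinct (T : eqType) (r : rel T) (l : seq T) : symmetric r ->
  uniq l ->
  reflect {in l &, forall i j, i != j -> r i j} (pairwise r l).
Proof.
move=> r_sym; elim: l => [|x l IHl] /=; first by move=> _; apply: ReflectT.
move=> /andP[xl /IHl{}IHl].
apply: (iffP andP) => [[/allP xr /IHl lr] i j|lr].
  rewrite !inE => /predU1P[->|il] /predU1P[->|jl]; rewrite ?eqxx // => ij.
  - exact: xr.
  - by rewrite r_sym xr.
  - exact: lr.
split; last by apply/IHl => i j il jl; apply: lr; rewrite inE ?il ?jl orbT.
apply/allP => j jl; apply: lr; rewrite ?mem_head // ?inE ?jl ?orbT //.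
by apply: contraNneq xl => ->.
Qed.

Variable k : nat.

Definition ord_rel (i j : 'I_k) := e i j.

Definition ord_seq (s : {set 'I_k}) := [seq val i | i <- enum s].

Lemma mem_ord_seq s (i : 'I_k) : (val i \in ord_seq s) = (i \in s).
Proof. by rewrite mem_map ?mem_enum //; exact: val_inj. Qed.

Lemma ord_seq_filter (s : {set 'I_k}) (p : pred nat) :
  (forall i : 'I_k, (i \in s) = p i) -> ord_seq s = seq.filter p (iota 0 k).
Proof.
move=> sp; rewrite /ord_seq -val_enum_ord filter_map {1}/enum_mem -enumT.
by congr map; apply: eq_filter.
Qed.

Lemma ord_seq_clique s : (ord_seq s \in cliques e (iota 0 k)) = clique ord_rel s.
Proof.
rewrite mem_cliques (@ord_seq_filter s [in ord_seq s]); last first.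
  by move=> i; rewrite -mem_ord_seq.
rewrite filter_subseq /= -(@ord_seq_filter s); last first.
  by move=> i; rewrite -mem_ord_seq.
rewrite pairwise_map.
have r_sym : symmetric (relpre val e : rel 'I_k) by move=> i j; exact: e_sym.
apply/(pairwise_distinct r_sym (enum_uniq s))/cliqueP => es i j.
  by move=> si sj; apply: es; rewrite mem_enum.
by rewrite !mem_enum; apply: es.
Qed.

Lemma sum_cliques (V : nmodType) (F : nat -> V) :
  \sum_(s : {set 'I_k} | clique ord_rel s) F #|s| =
  \sum_(c <- cliques e (iota 0 k)) F (size c).
Proof.
have inj : injective ord_seq.
  by move=> s t st; apply/setP => i; rewrite -!mem_ord_seq st.
rewrite -big_filter; set l := seq.filter _ _.
rewrite [RHS](perm_big (map ord_seq l)) ?big_map.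
  by apply: eq_bigr => s _; rewrite size_map cardE.
rewrite perm_sym; apply: uniq_perm.
- by rewrite map_inj_uniq // filter_uniq // index_enum_uniq.
- by rewrite cliques_uniq // iota_uniq.
move=> c; apply/mapP/idP => [[s + ->]|cl].
  by rewrite mem_filter ord_seq_clique => /andP[].
have cE : ord_seq [set i | val i \in c]%SET = c.
  rewrite (@ord_seq_filter _ [in c]); last by move=> i; rewrite inE.
  by move: cl; rewrite mem_cliques => /andP[/(subseq_uniqP (iota_uniq _ _))/esym].
exists [set i | val i \in c]%SET; last by rewrite cE.
by rewrite mem_filter mem_index_enum andbT -ord_seq_clique cE.
Qed.

End CliqueEnumeration.

Lemma sum_count (V : nmodType) (F : nat -> V) (l : seq (seq nat)) m :
  all (fun c => size c < m)%N l ->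
  \sum_(c <- l) F (size c) =
  \sum_(i < m) F i *+ count (fun c => size c == i) l.
Proof.
elim: l => [|c l IHl] /=; first by rewrite big_nil big1.
move=> /andP[cm lm]; rewrite big_cons IHl //.
under [RHS]eq_bigr do rewrite mulrnDr.
rewrite big_split /=; congr (_ + _).
rewrite (bigD1 (Ordinal cm)) //= eqxx mulr1n big1 ?addr0 // => i.
by rewrite -val_eqE /= eq_sym => /negPf->.
Qed.

(** * The truncated cube *)

(** The left-hand sides of the seventeen inequalities
    [facet_form m x <= facet_bound m]: the cube [-5, 5]^6, three cuts that turn
    its pairs of coordinates into pentagons, a cut of the face of the cube where
    coordinates 0 and 2 equal -5, and a cut of the face where cut 15 is tight and
    coordinate 4 equals -5.  The scale 5, 8, 11 gives each face an integral point
    in its relative interior.  The type of the values is a parameter because the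
    forms are evaluated both at integers, by computation, and at reals. *)
Definition facet_form (V : zmodType) (m : nat) (x : nat -> V) : V :=
  match m with
  | 0 | 1 | 2 | 3 | 4 | 5 => x m
  | 6 | 7 | 8 | 9 | 10 | 11 => - x (m - 6)%N
  | 12 => x 0%N + x 1%N
  | 13 => x 2%N + x 3%N
  | 14 => x 4%N + x 5%N
  | 15 => - x 0%N - x 2%N
  | _ => - x 0%N - x 2%N - x 4%N
  end.

Definition facet_bound (m : nat) : nat :=
  if (m < 12)%N then 5 else if (m < 16)%N then 8 else 11.

(** The pairs of disjoint facets: first the six pairs of opposite facets of the
    cube and the five pairs whose intersection is cut off, then for each cut the
    facets that miss it. *)
Definition nonadjacent : seq (nat * nat) :=
  [:: (0, 6); (1, 7); (2, 8); (3, 9); (4, 10); (5, 11);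
      (0, 1); (2, 3); (4, 5); (6, 8); (10, 15);
      (6, 12); (7, 12); (8, 13); (9, 13); (10, 14); (11, 14);
      (0, 15); (2, 15); (12, 15); (13, 15);
      (0, 16); (2, 16); (4, 16); (12, 16); (13, 16); (14, 16)]%N.

Definition adjacent (i j : nat) : bool :=
  ((i, j) \notin nonadjacent) && ((j, i) \notin nonadjacent).

(** How two coordinates share a prescribed sum: facet [i] forces [(u, v)], facet
    [j] forces [(u', v')], and [(m, m')] avoids both facets. *)
Definition share (c : seq nat) (i j : nat) (u v u' v' m m' : int) : int * int :=
  if i \in c then (u, v) else if j \in c then (u', v') else (m, m').

(** A point whose tight inequalities are exactly those in the clique [c].
    Coordinates that no facet in [c] constrains are put at 0, and a cut with
    index 12, 13 or 14 in [c] has its sum 8 shared by its two coordinates.  The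
    cuts 15 and 16 involve the negatives [y0], [y2], [y4] of coordinates 0, 2 and
    4: [y0 + y2] is 8 if 15 is tight, and [y0 + y2 + y4] is 11 if 16 is.  If 16 is
    tight but 15 is not, then [y0 + y2 < 8] is needed: [y4] is 5 if the cube
    facet 10 is in [c], and 4 otherwise. *)
Definition coordinates (c : seq nat) : seq int :=
  let free j := if j \in c then 5 else if j + 6 \in c then - 5 else 0 in
  let pair w i := if w \in c then share c i i.+1 5 3 3 5 4 4
                  else (free i, free i.+1) in
  let '(z0, z1) := pair 12 0 in
  let '(z2, z3) := pair 13 2 in
  let '(z4, z5) := pair 14 4 in
  let '(y0, y2, y4) :=
    if 16 \in c then
      if 15 \in c then (share c 6 8 5 3 3 5 4 4, 3)
      else if 10 \in c then (share c 6 8 5 1 1 5 3 3, 5)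
      else (share c 6 8 5 2 2 5 3 4, 4)
    else if 15 \in c then (share c 6 8 5 3 3 5 4 4, - z4)
    else (- z0, - z2, - z4) in
  [:: - y0; z1; - y2; z3; - y4; z5].

Definition realizes (c : seq nat) : bool :=
  all (fun m => let v := facet_form m (fun j => nth 0 (coordinates c) j) in
    (v <= (facet_bound m)%:Z) && ((v == (facet_bound m)%:Z) == (m \in c))) (iota 0 17).

Lemma cliques_realized : all realizes (cliques adjacent (iota 0 17)).
Proof. by vm_compute. Qed.

Lemma count_cliques :
  all (fun c => size c < 7)%N (cliques adjacent (iota 0 17)) &&
  ([seq count (fun c => size c == i) (cliques adjacent (iota 0 17)) | i <- iota 0 7]
   == [:: 1; 17; 109; 345; 575; 483; 161]%N).
Proof. by vm_compute. Qed.

Lemma adjacent_sym : symmetric adjacent.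
Proof. by move=> i j; rewrite /adjacent andbC. Qed.

Section TruncatedCube.
Context {R : realFieldType}.

Lemma facet_bound_gt0 m : 0 < (facet_bound m)%:R :> R.
Proof. by rewrite ltr0n /facet_bound; case: ifP => // _; case: ifP. Qed.

(** For each pair, adding up the two equalities and a few of the inequalities is
    contradictory; the linear arithmetic procedure finds the coefficients. *)
Lemma facets_disjoint (x : nat -> R) i j :
  (forall m, (m < 17)%N -> facet_form m x <= (facet_bound m)%:R) ->
  (i, j) \in nonadjacent ->
  facet_form i x = (facet_bound i)%:R -> facet_form j x = (facet_bound j)%:R -> False.
Proof.
move=> xP.
have := (xP 0 isT, xP 1 isT, xP 2 isT, xP 3 isT, xP 4 isT, xP 5 isT)%N.
have := (xP 6 isT, xP 7 isT, xP 8 isT, xP 9 isT, xP 10 isT, xP 11 isT)%N.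
have := (xP 12 isT, xP 13 isT, xP 14 isT, xP 15 isT, xP 16 isT)%N.
rewrite /facet_bound /= !inE.
move=> [[[[h12 h13] h14] h15] h16] [[[[[h6 h7] h8] h9] h10] h11].
move=> [[[[[h0 h1] h2] h3] h4] h5].
by do 26?[case/orP => [/eqP[-> ->] /= e1 e2|]; first by lra]; move=> /eqP[-> ->] /=; lra.
Qed.

Lemma facet_form_eq (V : zmodType) m (x y : nat -> V) :
  (forall l, (l < 6)%N -> x l = y l) -> facet_form m x = facet_form m y.
Proof. by move=> xy; do 16?[case: m => [|m]]; rewrite /= !xy. Qed.

Lemma facet_form_intr m (z : nat -> int) :
  facet_form m (fun l => (z l)%:~R : R) = (facet_form m z)%:~R.
Proof.
by do 16?[case: m => [|m]] => //=; rewrite ?rmorphB ?rmorphD ?rmorphN.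
Qed.

Definition normal (i : 'I_17) : 'rV[R]_6 :=
  \row_j ((facet_bound i)%:R^-1 * facet_form i (fun l => (l == j)%:R)).

Lemma dot_normal i (x : 'rV[R]_6) :
  dot (normal i) x = (facet_bound i)%:R^-1 * facet_form i (fun l => x 0 (inord l)).
Proof.
rewrite /dot; under eq_bigr do rewrite mxE -mulrA.
rewrite -mulr_sumr; congr (_ * _).
have xE (j : 'I_6) : x 0 j = x 0 (inord j) by rewrite inord_val.
under eq_bigr do rewrite xE.
rewrite !big_ord_recl big_ord0 /=.
by case: i; do 17?[case=> [|]] => //= *; rewrite /bump /=; ring.
Qed.

Lemma dot_normal_le i x :
  (dot (normal i) x <= 1) = (facet_form i (fun l => x 0 (inord l)) <= (facet_bound i)%:R).
Proof. by rewrite dot_normal mulrC ler_pdivrMr ?facet_bound_gt0 // mul1r. Qed.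

Lemma dot_normal_eq i x :
  (dot (normal i) x == 1) = (facet_form i (fun l => x 0 (inord l)) == (facet_bound i)%:R).
Proof.
by rewrite dot_normal mulrC -(inj_eq (mulIf (lt0r_neq0 (facet_bound_gt0 i))))
           divfK ?mul1r // lt0r_neq0 ?facet_bound_gt0.
Qed.

Lemma normal_bounded : bounded_polar normal.
Proof.
move=> y yP; have form_le0 m : (m < 17)%N -> facet_form m (fun l => y 0 (inord l)) <= 0.
  move=> m17; have := yP (Ordinal m17).
  by rewrite dot_normal pmulr_rle0 // invr_gt0 facet_bound_gt0.
apply/rowP => j; rewrite mxE -[j]inord_val; apply/eqP; rewrite eq_le.
have jle m : (m < 6)%N -> y 0 (inord m) <= 0 /\ - y 0 (inord m) <= 0.
  move=> m6; have m17 : (m < 17)%N by lia.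
  have m23 : (m + 6 < 17)%N by lia.
  move: (form_le0 _ m17) (form_le0 _ m23) m6 => {m17 m23}.
  by do 6?[case: m => [|m]].
by have [-> ] := jle j (ltn_ord j); rewrite oppr_le0 => ->.
Qed.

(** The normals of two opposite facets of the cube are opposite. *)
Lemma normal_hull0 : conv_hull normal 0.
Proof.
have -> : 0 = 2^-1 *: normal (inord 0) + 2^-1 *: normal (inord 6).
  apply/rowP => j; rewrite !mxE !inordK //= /facet_bound /= mulrN mulrN subrr.
  by [].
apply: conv_hull_convex; try exact: conv_hull_vertex; lra.
Qed.

Lemma normal_active_clique x :
  polar normal x -> clique (@ord_rel adjacent 17) (active normal x).
Proof.
move=> Px; apply/cliqueP => i j; rewrite !inE !dot_normal_eq => /eqP xi /eqP xj _.
have Fx m : (m < 17)%N -> facet_form m (fun l => x 0 (inord l)) <= (facet_bound m)%:R.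
  by move=> m17; have := Px (Ordinal m17); rewrite dot_normal_le.
by apply/andP; split; apply/negP => ij; exact: (facets_disjoint Fx ij).
Qed.

Lemma normal_clique_active s : clique (@ord_rel adjacent 17) s ->
  exists2 x, polar normal x & active normal x = s.
Proof.
rewrite -ord_seq_clique; last exact: adjacent_sym.
move=> /(allP cliques_realized)/allP; set z := coordinates _ => zP.
pose x : 'rV[R]_6 := \row_j (z`_j)%:~R.
have xE (i : 'I_17) : facet_form i (fun l => x 0 (inord l)) =
    (facet_form i (fun l => z`_l))%:~R.
  by rewrite -facet_form_intr; apply: facet_form_eq => l l6; rewrite mxE inordK.
have iP (i : 'I_17) := zP i; exists x => [i|].
  have /iP/andP[+ _] : val i \in iota 0 17 by rewrite mem_iota /=.
  by rewrite dot_normal_le xE pmulrn ler_int.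
apply/setP => i; have /iP/andP[_ /eqP] : val i \in iota 0 17 by rewrite mem_iota /=.
by rewrite mem_ord_seq inE dot_normal_eq xE pmulrn eqr_int => <-.
Qed.

End TruncatedCube.

(** * Nonreal roots *)

(** The numbers of cliques by size, 1, 17, 109, 345, 575, 483, 161, are the coefficients
    of the right-hand side expanded in powers of ['X]. *)
Lemma f_polynomial_cliques (s := ('X + 'X^2 : {poly int})) :
  \sum_(c <- cliques adjacent (iota 0 17)) ('X^(size c) : {poly int}) =
  1 + 17 * s + 92 * s ^+ 2 + 161 * s ^+ 3.
Proof.
have := count_cliques; move: (cliques adjacent (iota 0 17)) => l /andP[lt7 /eqP].
move=> [c0 c1 c2 c3 c4 c5 c6].
rewrite (sum_count (fun i => 'X^i) lt7) !big_ord_recl big_ord0 /=.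
rewrite /bump /= c0 c1 c2 c3 c4 c5 c6 /s; ring.
Qed.

(** Let [r] be a real root.  The other two are those of
    y^2 + (17 + r)y + r^2 + 17r + 92, whose discriminant is [- d].  If q' is the
    derivative of the cubic, q'(r)^2 (- d) is the discriminant -23 of the cubic,
    so [d] is positive. *)
Lemma cubic_nonreal_root (R : rcfType) :
  exists2 y : R[i], y ^+ 3 + 17 * y ^+ 2 + 92 * y + 161 = 0
    & y \isn't Num.real.
Proof.
pose q : {poly R} := 'X^3 + 17 *: 'X^2 + 92 *: 'X + 161%:P.
have qE r : q.[r] = r ^+ 3 + 17 * r ^+ 2 + 92 * r + 161.
  by rewrite /q !(hornerD, hornerXn, hornerZ, hornerX, hornerC).
have [r _ /rootP] : exists2 r, r \in `[- 9, 0] & root q r.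
  by apply: poly_ivt; [|rewrite !qE; apply/andP; split]; lra.
rewrite qE => r0.
pose d := 3 * r ^+ 2 + 34 * r + 79.
have d_gt0 : 0 < d.
  have dE : (3 * r ^+ 2 + 34 * r + 92) ^+ 2 * d = 23.
    apply/eqP; rewrite -subr_eq0; apply/eqP.
    (* The second factor is the quotient in the division by the cubic. *)
    transitivity ((r ^+ 3 + 17 * r ^+ 2 + 92 * r + 161) *
      (27 * r ^+ 3 + 459 * r ^+ 2 + 2484 * r + 4153)).
      by rewrite /d; ring.
    by rewrite r0 mul0r.
  rewrite ltNge; apply/negP => d_le0.
  have := mulr_ge0_le0 (sqr_ge0 (3 * r ^+ 2 + 34 * r + 92)) d_le0.
  by rewrite dE lern0.
pose rho : R[i] := (r%:C)%C; pose delta : R[i] := sqrtC (- (d%:C)%C).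
have rho0 : rho ^+ 3 + 17 * rho ^+ 2 + 92 * rho + 161 = 0.
  have := congr1 (real_complex R) r0.
  by rewrite 3!rmorphD rmorphXn rmorphM rmorphXn rmorphM 3!rmorph_nat rmorph0.
have delta2 : delta ^+ 2 = - (3 * rho ^+ 2 + 34 * rho + 79).
  by rewrite sqrtCK /d 2!rmorphD rmorphM rmorphXn rmorphM 3!rmorph_nat.
pose y := (delta - (17 + rho)) / 2.
have deltaE : delta = 2 * y + (17 + rho) by rewrite /y; field.
exists y.
  transitivity ((y - rho) * (delta ^+ 2 + (3 * rho ^+ 2 + 34 * rho + 79))
    / 4 + (rho ^+ 3 + 17 * rho ^+ 2 + 92 * rho + 161)).
    by rewrite deltaE; field.
  by rewrite delta2 addNr mulr0 mul0r add0r rho0.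
apply/negP => y_real; have delta_real : delta \is Num.real.
  by rewrite deltaE; apply: realD; [apply: realM | apply: realD];
    rewrite ?realn ?complex_real.
have := real_exprn_even_ge0 delta_real (isT : ~~ odd 2).
by rewrite sqrtCK oppr_ge0 lecR leNgt d_gt0.
Qed.

Lemma f_polynomial_nonreal_root (R : rcfType) (s := ('X + 'X^2 : {poly int})) :
  has_nonreal_root R (1 + 17 * s + 92 * s ^+ 2 + 161 * s ^+ 3).
Proof.
have [y y0 y_nonreal] := cubic_nonreal_root R.
have y_neq0 : y != 0 by apply: contraNneq y_nonreal => ->; rewrite real0.
have [t tE] := solve_monicpoly (fun i => [:: y^-1; -1]`_i) (isT : (0 < 2)%N).
rewrite !big_ord_recl big_ord0 /= expr0 expr1 mulr1 addr0 mulN1r in tE.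
have ts : t + t ^+ 2 = y^-1 by rewrite tE addrC addrNK.
exists t; split; last first.
  apply: contra y_nonreal => t_real; rewrite -[y]invrK realV -ts.
  by rewrite realD ?realX.
have [phi phiE] : exists phi : {rmorphism {poly int} -> R[i]},
    forall p, phi p = (map_poly intr p).[t].
  by exists (horner_eval t \o map_poly intr).
have phis : phi s = y^-1.
  by rewrite rmorphD rmorphXn phiE map_polyX hornerX.
apply/rootP; rewrite -phiE 3!rmorphD rmorph1 rmorphM rmorphM rmorphXn rmorphM rmorphXn
  3!rmorph_nat phis.
transitivity ((y ^+ 3 + 17 * y ^+ 2 + 92 * y + 161) / y ^+ 3).
  by field.
by rewrite y0 mul0r.
Qed.

Theorem mainTheorem5 (R : realType) :
  exists (n : nat) (P : set 'rV[R]_n) (m : nat) (Q : set 'rV[R]_m),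
    [/\ simple_polytope P,
        simplicial_polytope Q,
        dual_polytopes P Q,
        flag_complex (boundary_complex Q)
      & has_nonreal_root R (f_polynomial (boundary_complex Q))].
Proof.
have bnd := @normal_bounded R; have h0 := @normal_hull0 R.
have act := @normal_active_clique R; have real := @normal_clique_active R.
have fac := clique_facial act real.
exists 6, (polar normal), 6, (conv_hull normal); split.
- exact: polar_simple bnd fac.
- exact: hull_simplicial bnd h0 fac.
- exact: polar_dual bnd h0.
- exact: boundary_flag bnd h0 act real.
rewrite (f_polynomial_boundary bnd h0 act real).
rewrite (sum_cliques adjacent_sym 17 (fun m => 'X^m)) f_polynomial_cliques.
exact: f_polynomial_nonreal_root.
Qed.
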